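(* Let $n$ be a positive integer, let $\mathcal{F}\subseteq\mathcal{P}([n])$, and let $T(\mathcal{F})$ be the shifted family obtained from $\mathcal{F}$ by successively applying the down-shifts $T_j$ for $j=1,2,\ldots,n$ in this order. Then $$T(\mathcal{F})=\operatorname{osh}(\mathcal{F}).$$
   Context: $[n]=\{1,\ldots,n\}$; $[a,b]=\{a,a+1,\ldots,b\}$, which is empty if $a>b$; $\mathcal{P}(A)$ is the set of all subsets of $A$. Order shattering. Let $S\subseteq[n]$ and $\mathcal{F}\subseteq\mathcal{P}([n])$. Inductively: $S=\varnothing$ is order shattered by $\mathcal{F}$ iff $\mathcal{F}\neq\varnothing$. If $S=\{s_1<s_2<\cdots<s_k\}$ with $k\ge1$, then $S$ is order shattered by $\mathcal{F}$ iff there exist disjoint families $\widetilde{\mathcal{F}_0},\widetilde{\mathcal{F}_1}\subseteq\mathcal{F}$, each of size $2^{k-1}$, such that, with $T=[s_k+1,n]$ (possibly empty): (a) $T\cap C=T\cap D$ for all $C\in\widetilde{\mathcal{F}_0}$ and $D\in\widetilde{\mathcal{F}_1}$; (b) $s_k\notin C$ and $s_k\in D$ for all $C\in\widetilde{\mathcal{F}_0}$ and $D\in\widetilde{\mathcal{F}_1}$; (c) each of $\widetilde{\mathcal{F}_0}$ and $\widetilde{\mathcal{F}_1}$ individually order shatters $S\setminus\{s_k\}$. Then $\operatorname{osh}(\mathcal{F})=\{S\subseteq[n]:\mathcal{F}\text{ order shatters }S\}$. Down-shift. For $j\in[n]$, a family $\mathcal{F}\subseteq\mathcal{P}([n])$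 and $B\in\mathcal{F}$, let $T_j(B)=B$ if $j\notin B$ or $B\setminus\{j\}\in\mathcal{F}$, and $T_j(B)=B\setminus\{j\}$ if $j\in B$ and $B\setminus\{j\}\notin\mathcal{F}$. Let $T_j(\mathcal{F})=\{T_j(B):B\in\mathcal{F}\}$. Then $T(\mathcal{F})=T_n(T_{n-1}(\cdots T_1(\mathcal{F})\cdots))$. *)

(* Defs.v *)
From mathcomp Require Import all_boot.

Set Implicit Arguments.
Unset Strict Implicit.
Unset Printing Implicit Defensive.

(* [n] = {1, ..., n} is represented by 'I_n = {0, ..., n-1}
   with its usual order (ordinals compare as natural numbers). *)

(* The argument k is the cardinal of the set S to be shattered: it only
   serves as the structurally decreasing argument of the recursion on |S|. *)
Fixpoint order_shatters_rec (n k : nat) (F : {set {set 'I_n}}) (S : {set 'I_n})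
    : bool :=
  if k is k'.+1 then
    [exists s in S, exists F0 : {set {set 'I_n}}, exists F1 : {set {set 'I_n}},
      [&& [forall t in S, t <= s],
          F0 \subset F, F1 \subset F, [disjoint F0 & F1],
          #|F0| == 2 ^ k', #|F1| == 2 ^ k',
          [forall C in F0, forall D in F1,
             [set t : 'I_n | s < t] :&: C == [set t : 'I_n | s < t] :&: D],
          [forall C in F0, forall D in F1, (s \notin C) && (s \in D)],
          order_shatters_rec k' F0 (S :\ s) &
          order_shatters_rec k' F1 (S :\ s)]]
  else F != set0.

Definition order_shatters (n : nat) (F : {set {set 'I_n}}) (S : {set 'I_n})
    : bool :=
  order_shatters_rec #|S| F S.

Definition osh (n : nat) (F : {set {set 'I_n}}) : {set {set 'I_n}} :=
  [set S | order_shatters F S].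

Lemma order_shatters0 (n : nat) (F : {set {set 'I_n}}) :
  order_shatters F set0 = (F != set0).
Proof. by rewrite /order_shatters cards0. Qed.

Lemma order_shattersP (n : nat) (F : {set {set 'I_n}}) (S : {set 'I_n})
    (s : 'I_n) (sS : s \in S) (smax : forall t, t \in S -> t <= s) :
  let T := [set t : 'I_n | s < t] in
  order_shatters F S <->
  exists F0 F1 : {set {set 'I_n}},
    [/\ F0 \subset F, F1 \subset F, [disjoint F0 & F1],
        #|F0| = 2 ^ #|S|.-1 & #|F1| = 2 ^ #|S|.-1] /\
    [/\ forall C D, C \in F0 -> D \in F1 -> T :&: C = T :&: D,
        forall C D, C \in F0 -> D \in F1 -> s \notin C /\ s \in D,
        order_shatters F0 (S :\ s) & order_shatters F1 (S :\ s)].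
Proof.
move=> T; have cS : #|S| = #|S :\ s|.+1 by rewrite (cardsD1 s S) sS.
rewrite /order_shatters cS /=; split.
  case/exists_inP=> s' s'S /existsP[F0 /existsP[F1]].
  case/and5P=> /forall_inP le_s' F0F F1F dis
    /and5P[/eqP c0 /eqP c1 /forall_inP ha /forall_inP hb /andP[h0 h1]].
  have es : s' = s.
    by apply/val_inj/eqP; rewrite eqn_leq smax //= le_s'.
  rewrite {}es in ha hb h0 h1.
  exists F0, F1; split; split=> // C D CF DF.
    by apply/eqP; move/forall_inP: (ha C CF); apply.
  by apply/andP; move/forall_inP: (hb C CF); apply.
case=> F0 [F1 [[F0F F1F dis c0 c1] [ha hb h0 h1]]].
apply/exists_inP; exists s => //; apply/existsP; exists F0; apply/existsP.
exists F1; rewrite F0F F1F dis c0 c1 h0 h1 eqxx !andbT /=.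
apply/and3P; split; first by apply/forall_inP.
  by apply/forall_inP=> C CF; apply/forall_inP=> D DF; apply/eqP; apply: ha.
by apply/forall_inP=> C CF; apply/forall_inP=> D DF; apply/andP; apply: hb.
Qed.

Definition downshift_set (n : nat) (j : 'I_n) (F : {set {set 'I_n}})
    (B : {set 'I_n}) : {set 'I_n} :=
  if (j \in B) && (B :\ j \notin F) then B :\ j else B.

Definition downshift (n : nat) (j : 'I_n) (F : {set {set 'I_n}})
    : {set {set 'I_n}} :=
  [set downshift_set j F B | B in F].

(* enum 'I_n is increasing, so the shift at the least element acts first. *)
Definition shifted (n : nat) (F : {set {set 'I_n}}) : {set {set 'I_n}} :=
  foldl (fun G j => downshift j G) F (enum 'I_n).

(* Main.v *)
Require Import Defs.
From mathcomp Require Import all_boot.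

(** Apply the shifts one at a time, and follow what membership in the
    intermediate family means.  After the shifts at the elements below [j],
    the elements from [j] on have not been touched, and a set [S] lies in the
    shifted family exactly when its lower part (the elements below [j]) is
    order shattered by the members of [F] that have the same upper part as
    [S]; these members form [fiber F j S].

    With no shift done this says that [S] is in [F]; with all shifts done it
    says that [F] order shatters [S].  For the inductive step, a set containing
    [j] survives the shift at [j] iff both [S] and [S :\ j] were present, and
    a set avoiding [j] is there afterwards iff [S] or [j |: S] was present
    ([in_downshift]).  Order shattering obeys the same recursion.  When [j] is
    the largest element to be shattered, the two witnessing families agree
    above [j] and are separated by [j], so they live in the two halves, at [j],
    of one fiber ([order_shatters_fiber_mem]); conversely the two halves supply
    witnesses of the prescribed size, because a shattering family always
    contains a minimal one ([order_shatters_minimal]).  When all elements to be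
    shattered are below [j], the witnesses agree at [j], so that one half of
    the fiber already shatters ([order_shatters_fiber_notin]). *)

Set Implicit Arguments.
Unset Strict Implicit.
Unset Printing Implicit Defensive.

Section OrderShattering.

Variable n : nat.
Implicit Types (F G : {set {set 'I_n}}) (A B C S X : {set 'I_n}) (s t : 'I_n).

Lemma set_max_elt S : S != set0 ->
  exists2 s, s \in S & forall t, t \in S -> t <= s.
Proof.
case/set0Pn=> s0 s0S; case: (arg_maxnP (fun t : 'I_n => t : nat) s0S) => s sS hs.
by exists s.
Qed.

Lemma order_shatters_sub F G S :
  F \subset G -> order_shatters F S -> order_shatters G S.
Proof.
move=> sFG; have [->|/set_max_elt[s sS smax]] := eqVneq S set0.
  rewrite !order_shatters0 => /set0Pn[C CF]; apply/set0Pn; exists C.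
  exact: (subsetP sFG).
move/(order_shattersP F sS smax) => [F0 [F1 [[s0 s1 d c0 c1] h]]].
apply/(order_shattersP G sS smax); exists F0, F1; split=> //.
by split=> //; apply: subset_trans sFG.
Qed.

(** The cardinalities required of the witnesses in order shattering are no
    restriction: any shattering family can be thinned out to one with
    [2 ^ #|S|] members, namely the union of the two witnesses. *)
Lemma order_shatters_minimal F S : order_shatters F S ->
  exists G, [/\ G \subset F, #|G| = 2 ^ #|S| & order_shatters G S].
Proof.
have [->|/set_max_elt[s sS smax]] := eqVneq S set0.
  rewrite order_shatters0 => /set0Pn[C CF]; exists [set C].
  rewrite sub1set CF cards1 cards0 order_shatters0; split=> //.
  by apply/set0Pn; exists C; rewrite set11.
move/(order_shattersP F sS smax) => [F0 [F1 [[s0 s1 d c0 c1] h]]].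
exists (F0 :|: F1); rewrite subUset s0 s1; split=> //.
  rewrite cardsU (disjoint_setI0 d) cards0 subn0 c0 c1 addnn -mul2n -expnS.
  by rewrite prednK // (cardsD1 s) sS.
apply/(order_shattersP _ sS smax); exists F0, F1; split=> //.
by split=> //; [apply: subsetUl | apply: subsetUr].
Qed.

Lemma order_shatters_neq0 F S : order_shatters F S -> F != set0.
Proof.
case/order_shatters_minimal=> G [sGF cG _].
apply: contraTneq sGF => ->; rewrite subset0 -card_gt0 cG.
by rewrite expn_gt0.
Qed.

(** The index [j] is a natural number and not an ordinal, so that [j = n] is
    possible; the fiber is then the whole family. *)
Definition fiber F (j : nat) X : {set {set 'I_n}} :=
  [set C in F | [forall t : 'I_n, (j <= t) ==> ((t \in C) == (t \in X))]].

Definition below (j : nat) : {set 'I_n} := [set t : 'I_n | t < j].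

Lemma in_fiberP F j X C :
  reflect (C \in F /\ forall t, j <= t -> (t \in C) = (t \in X))
          (C \in fiber F j X).
Proof.
rewrite inE; apply: (iffP andP) => -[CF h]; split=> //.
  by move=> t jt; apply/eqP; apply: (implyP (forallP h t)).
by apply/forallP=> t; apply/implyP=> jt; apply/eqP/h.
Qed.

Lemma fiberS F (j : 'I_n) X :
  fiber F j.+1 X = fiber F j (X :\ j) :|: fiber F j (j |: X).
Proof.
apply/setP=> C; rewrite in_setU; apply/in_fiberP/orP.
  case=> CF h.
  suff CjX t : j <= t ->
      (t \in C) = (t \in if j \in C then j |: X else X :\ j).
    by case: (j \in C) CjX => CjX; [right | left]; apply/in_fiberP.
  rewrite leq_eqVlt => /predU1P[/val_inj <-|jt].
    by case: (j \in C); rewrite ?setU11 ?setD11.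
  have tj : t != j by apply: contraTneq jt => ->; rewrite ltnn.
  by rewrite h //; case: (j \in C); rewrite !inE ?(negbTE tj) ?tj.
by case=> /in_fiberP[CF h]; split=> // t jt; rewrite h ?(ltnW jt) // !inE;
  have /negbTE-> : t != j by apply: contraTneq jt => ->; rewrite ltnn.
Qed.

Lemma order_shatters_fiber_mem F (j : 'I_n) X A :
    j \in A -> A \subset below j.+1 ->
  order_shatters (fiber F j.+1 X) A =
    order_shatters (fiber F j (X :\ j)) (A :\ j) &&
    order_shatters (fiber F j (j |: X)) (A :\ j).
Proof.
move=> jA /subsetP Aj.
have jmax t : t \in A -> t <= j by move/Aj; rewrite inE.
have cA : #|A|.-1 = #|A :\ j| by rewrite (cardsD1 j A) jA.
apply/idP/andP.
  move/(order_shattersP _ jA jmax) => [F0 [F1 [[s0 s1 _ _ _] [_ sep h0 h1]]]].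
  (* That [F0] avoids [j] and [F1] contains it is only given for pairs, so
     each needs a member of the other. *)
  have /set0Pn[C0 C0F] := order_shatters_neq0 h0.
  have /set0Pn[D0 D0F] := order_shatters_neq0 h1.
  split; [apply: order_shatters_sub h0 | apply: order_shatters_sub h1];
    apply/subsetP=> C CF.
    have := subsetP s0 C CF; rewrite fiberS in_setU => /orP[//|/in_fiberP[_ h]].
    have [] := sep C D0 CF D0F.
    by rewrite h // setU11.
  have := subsetP s1 C CF; rewrite fiberS in_setU => /orP[/in_fiberP[_ h]|//].
  have [] := sep C0 C C0F CF.
  by rewrite h // setD11.
case=> /order_shatters_minimal[F0 [s0 c0 h0]].
move=> /order_shatters_minimal[F1 [s1 c1 h1]].
have sep C D : C \in F0 -> D \in F1 -> j \notin C /\ j \in D.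
  move=> /(subsetP s0)/in_fiberP[_ hC] /(subsetP s1)/in_fiberP[_ hD].
  by rewrite hC // hD // setD11 setU11.
apply/(order_shattersP _ jA jmax); exists F0, F1; rewrite cA; split; split=> //.
- by rewrite fiberS; apply: subset_trans s0 (subsetUl _ _).
- by rewrite fiberS; apply: subset_trans s1 (subsetUr _ _).
- rewrite -setI_eq0; apply/eqP/setP=> C; rewrite !inE; apply/negbTE/negP=> /andP[C0 C1].
  by have [/negP] := sep C C C0 C1.
- move=> C D /(subsetP s0)/in_fiberP[_ hC] /(subsetP s1)/in_fiberP[_ hD].
  apply/setP=> t; rewrite !in_setI inE; case: ltnP => //= jt.
  rewrite hC ?(ltnW jt) // hD ?(ltnW jt) // !inE.
  by have /negbTE-> : t != j by apply: contraTneq jt => ->; rewrite ltnn.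
Qed.

Lemma order_shatters_fiber_notin F (j : 'I_n) X A : A \subset below j ->
  order_shatters (fiber F j.+1 X) A =
    order_shatters (fiber F j (X :\ j)) A ||
    order_shatters (fiber F j (j |: X)) A.
Proof.
move=> /subsetP Aj; rewrite fiberS; apply/idP/orP; last first.
  by case; apply: order_shatters_sub; [apply: subsetUl | apply: subsetUr].
have [->|/set_max_elt[s sA smax]] := eqVneq A set0.
  rewrite !order_shatters0 setU_eq0 negb_and => /orP[]; first by left.
  by right.
have sj : s < j by have := Aj s sA; rewrite inE.
move/(order_shattersP _ sA smax) => [F0 [F1 [[s0 s1 d c0 c1] [agree sep h0 h1]]]].
have agreej C D : C \in F0 -> D \in F1 -> (j \in C) = (j \in D).
  by move=> CF DF; have /setP/(_ j) := agree C D CF DF; rewrite !inE sj.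
have /set0Pn[C0 C0F] := order_shatters_neq0 h0.
have /set0Pn[D0 D0F] := order_shatters_neq0 h1.
(* Comparing within one witness goes through a member of the other one, as
   agreement is only imposed across the two. *)
have const C : C \in F0 :|: F1 -> (j \in C) = (j \in C0).
  by case/setUP=> CF; [rewrite (agreej C0 D0) // (agreej C D0)
                      | rewrite (agreej C0 C)].
have sU : F0 :|: F1 \subset fiber F j (if j \in C0 then j |: X else X :\ j).
  apply/subsetP=> C CF.
  have : C \in fiber F j (X :\ j) :|: fiber F j (j |: X).
    by case/setUP: (CF); apply/subsetP.
  rewrite -(const C CF) in_setU.
  case/orP=> hC; case/in_fiberP: (hC) => _ /(_ j (leqnn j)) ->.
    by rewrite setD11.
  by rewrite setU11.
have hU : order_shatters (F0 :|: F1) A.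
  apply/(order_shattersP _ sA smax); exists F0, F1; split; split=> //.
    exact: subsetUl.
  exact: subsetUr.
have := order_shatters_sub sU hU.
by case: (j \in C0); [right | left].
Qed.

Lemma in_downshift (j : 'I_n) F S :
  (S \in downshift j F) =
    if j \in S then (S :\ j \in F) && (S \in F)
    else (S \in F) || (j |: S \in F).
Proof.
apply/imsetP/idP.
  case=> B BF ->; rewrite /downshift_set.
  have [jB|jB] := boolP (j \in B); last by rewrite (negbTE jB) BF.
  have [BjF|BjF] := boolP (B :\ j \in F); first by rewrite jB BjF.
  by rewrite setD11 setD1K // BF orbT.
case: ifPn => jS.
  by case/andP=> SjF SF; exists S; rewrite // /downshift_set SjF andbF.
have [SF _|SF /= jSF] := boolP (S \in F).
  by exists S; rewrite // /downshift_set (negbTE jS).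
by exists (j |: S); rewrite // /downshift_set setU11 setU1K // SF.
Qed.

Lemma setIbelowS (j : 'I_n) S : S :&: below j.+1 :\ j = S :&: below j.
Proof.
apply/setP=> t; rewrite !inE ltnS ltn_neqAle -val_eqE /=.
by rewrite andbCA.
Qed.

Lemma setIbelowU1 (j : 'I_n) S : (j |: S) :&: below j = S :&: below j.
Proof.
apply/setP=> t; rewrite !inE; case: eqP => //= ->.
by rewrite ltnn !andbF.
Qed.

Lemma setIbelowD1 (j : 'I_n) S : (S :\ j) :&: below j = S :&: below j.
Proof.
apply/setP=> t; rewrite !inE; case: eqP => //= ->.
by rewrite ltnn !andbF.
Qed.

(** The invariant of the successive shifts: [j] counts the shifts done, which
    are those at the elements of [below j]. *)
Lemma mem_partial_shift F (j : nat) S : j <= n ->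
  (S \in foldl (fun G i => downshift i G) F (take j (enum 'I_n))) =
  order_shatters (fiber F j S) (S :&: below j).
Proof.
elim: j S => [|j IHj] S jn.
  have -> : below 0 = set0 by apply/setP=> t; rewrite !inE.
  rewrite take0 setI0 order_shatters0 /=; apply/idP/set0Pn.
    by move=> SF; exists S; apply/in_fiberP.
  case=> C /in_fiberP[CF h]; suff <- : C = S by [].
  by apply/setP=> t; apply: h.
pose i := Ordinal jn.
have -> : take j.+1 (enum 'I_n) = rcons (take j (enum 'I_n)) i.
  rewrite (take_nth i) ?size_enum_ord //; congr rcons.
  by apply: val_inj; rewrite /= nth_enum_ord.
rewrite foldl_rcons in_downshift !IHj ?(ltnW jn) //.
rewrite -[j]/(val i) setIbelowU1 setIbelowD1.
have [iS|iS] := boolP (i \in S).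
  rewrite order_shatters_fiber_mem ?setIbelowS ?subsetIr //.
    by rewrite (setUidPr _) ?sub1set.
  by rewrite !inE iS /=.
have eqS : S :&: below i.+1 = S :&: below i.
  by rewrite -setIbelowS (setDidPl _) // disjoint_sym disjoints1 inE (negbTE iS).
rewrite eqS order_shatters_fiber_notin ?subsetIr //.
by rewrite (setDidPl _) // disjoint_sym disjoints1.
Qed.

End OrderShattering.

Theorem theorem2p2 (n : nat) (n_gt0 : 0 < n) (F : {set {set 'I_n}}) :
  shifted F = osh F.
Proof.
apply/setP=> S; rewrite [in RHS]inE /shifted.
rewrite -[enum _]take_size size_enum_ord mem_partial_shift //.
congr order_shatters.
  apply/setP=> C; apply/in_fiberP/idP => [[]//|CF]; split=> // t.
  by rewrite leqNgt ltn_ord.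
by apply/setIidPl/subsetP=> t _; rewrite inE ltn_ord.
Qed.
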